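(* Let $a\in\mathbb{Z}$ with $3\nmid a$, and let $f_a(x) = -8ax^3-(8a+2)x^2+(4a-1)x+a$. Then the reduction of $f_a$ modulo $3$ is irreducible over $\mathbb{Z}/3$, and consequently $f_a$ is irreducible in $\mathbb{Z}[x]$. *)

(* Defs.v *)
From HB Require Import structures.
From mathcomp Require Import all_boot all_order all_algebra.

Set Implicit Arguments.
Unset Strict Implicit.
Unset Printing Implicit Defensive.

Import GRing.Theory.
Local Open Scope ring_scope.

(* Irreducibility of an element of an integral domain.  For {poly int} this is
   stronger than [irreducible_poly], whose divisibility is pseudo-division: it
   excludes, e.g., 2 *: 'X, because 2%:P is not a unit of {poly int}. *)
Definition irreducible_elt (D : idomainType) (p : D) : Prop :=
  [/\ p != 0, p \isn't a GRing.unit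
    & forall q r : D, p = q * r ->
        q \is a GRing.unit \/ r \is a GRing.unit].

Definition f_ (a : int) : {poly int} :=
  (- 8 * a) *: 'X^3 - (8 * a + 2) *: 'X^2 + (4 * a - 1) *: 'X + a%:P.

(* Main.v *)
Require Import Defs.
From HB Require Import structures.
From mathcomp Require Import all_boot all_order all_algebra.
From mathcomp Require Import ring.

Set Implicit Arguments.
Unset Strict Implicit.
Unset Printing Implicit Defensive.

Import GRing.Theory.
Local Open Scope ring_scope.

(** Reduction to a field, when it does not kill the leading coefficient,
    preserves the degrees of all factors, so a factor of a polynomial with
    irreducible reduction is constant or has a constant cofactor.  Primitivity
    makes constant factors units; here it holds because [a] and [4 a - 1] are
    coprime coefficients of [f_ a].  Modulo 3, [f_ a] becomes
    [a x^3 + (a + 1) x^2 + (a - 1) x + a], which for [a = 1, 2] is a cubic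
    without roots in ['F_3]. *)

Lemma irreducible_elt_of_map (D : idomainType) (K : fieldType)
    (phi : {rmorphism D -> K}) (p : {poly D}) :
    phi (lead_coef p) != 0 ->
    (forall c q, p = c *: q -> c \is a GRing.unit) ->
    irreducible_poly (map_poly phi p) ->
  irreducible_elt p.
Proof.
move=> lcp prim [szp irr].
have p0 : p != 0 by apply: contra_neq lcp => ->; rewrite lead_coef0 rmorph0.
have szpE : size (map_poly phi p) = size p by apply: size_poly_eq.
have const q r : p = q * r -> size (map_poly phi q) = 1%N ->
    q \is a GRing.unit.
  move=> pE szq1.
  (* The image of [lead_coef q] divides the nonzero image of [lead_coef p], so reduction keeps the
     size of [q]. *)
  have lcq : phi (lead_coef q) != 0.
    by move: lcp; rewrite pE lead_coefM rmorphM mulf_eq0 negb_or => /andP[].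
  have /eqP/size_poly1P[c _ qE] : size q = 1%N.
    by rewrite -szq1; apply/esym/size_poly_eq.
  rewrite qE; apply/rmorph_unit/(prim c r).
  by rewrite pE qE mul_polyC.
split=> // [|q r pE].
  rewrite poly_unitE; apply/nandP; left.
  by rewrite -szpE neq_ltn szp orbT.
have [sq1|sqN1] := eqVneq (size (map_poly phi q)) 1%N.
  by left; apply: const pE sq1.
right; apply: (const r q); first by rewrite mulrC.
have mE : map_poly phi p = map_poly phi q * map_poly phi r.
  by rewrite pE rmorphM.
have m0 : map_poly phi p != 0 by rewrite -size_poly_gt0 ltnW.
have /eqp_size szE : map_poly phi q %= map_poly phi p.
  by apply: irr => //; rewrite mE dvdp_mulr.
move: (m0); rewrite mE mulf_eq0 negb_or => /andP[q0 r0].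
(* For nonzero factors, the size of a product is the sum of the sizes minus one; equal sizes for [q]
   and [p] after reduction thus force size 1 for [r]. *)
move: szE; rewrite mE size_mul //.
move: q0 r0; rewrite -!size_poly_gt0.
case: (size _) => // m _; case: (size _) => // n _.
by rewrite addnS /= addSn => -[/eqP]; rewrite -{1}[m]addn0 eqn_add2l => /eqP <-.
Qed.

Lemma f_Poly (a : int) : f_ a = Poly [:: a; 4 * a - 1; - (8 * a + 2); - 8 * a].
Proof.
apply/polyP => i; rewrite /f_ !(coefD, coefN, coefZ, coefXn, coefX, coefC) coef_Poly.
by case: i => [|[|[|[|i]]]] /=; rewrite ?nth_nil; ring.
Qed.

Lemma f_primitive (a : int) (c : int) (q : {poly int}) :
  f_ a = c *: q -> c \is a GRing.unit.
Proof.
move=> fE.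
have c0 : a = c * q`_0 by rewrite -coefZ -fE f_Poly coef_Poly.
have c1 : 4 * a - 1 = c * q`_1 by rewrite -coefZ -fE f_Poly coef_Poly.
(* The inverse of [c] comes from [4 * a - (4 * a - 1) = 1], as [c] divides both terms. *)
apply/unitrPr; exists (4 * q`_0 - q`_1).
by rewrite mulrBr -c1 mulrCA -c0; ring.
Qed.

Lemma intr_F3_eq0 (a : int) : (a%:~R == 0 :> 'F_3) = (3 %| a)%Z.
Proof.
have three0 : (3 : int)%:~R = 0 :> 'F_3 by apply/eqP.
rewrite (sameP dvdz_mod0P eqP) {1}(divz_eq a 3) intrD intrM three0 mulr0 add0r.
have := modz_ge0 a (isT : 3 != 0 :> int).
have := ltz_pmod a (isT : 0 < 3 :> int).
by case: (a %% 3)%Z => // -[|[|[|n]]].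
Qed.

(** The explicit quotient [c] turns a congruence modulo 3 into an integer identity that [ring] can
    check. *)
Lemma intr_F3_eq (a b c : int) : a = b + c * 3 -> a%:~R = b%:~R :> 'F_3.
Proof.
move=> ->; apply/eqP; rewrite -subr_eq0 -intrB intr_F3_eq0 addrAC subrr add0r.
exact: dvdz_mull.
Qed.

Lemma horner_cubic (R : comNzRingType) (c0 c1 c2 c3 x : R) :
  (Poly [:: c0; c1; c2; c3]).[x] = c3 * x ^+ 3 + c2 * x ^+ 2 + c1 * x + c0.
Proof. by rewrite horner_Poly /=; ring. Qed.

(** Two nonzero values of [b] and three of [x] leave six evaluations, each done by computation. *)
Lemma cubic_F3_no_root (b x : 'F_3) :
  b != 0 -> b * x ^+ 3 + (b + 1) * x ^+ 2 + (b - 1) * x + b != 0.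
Proof. by case: b => -[|[|[|m]]] // ?; case: x => -[|[|[|n]]]. Qed.

Lemma map_f_F3 (a : int) (b := a%:~R : 'F_3) :
  map_poly (intr : int -> 'F_3) (f_ a) = Poly [:: b; b - 1; b + 1; b].
Proof.
apply/polyP => i; rewrite coef_map f_Poly !coef_Poly.
case: i => [|[|[|[|i]]]] /=; rewrite ?nth_nil //.
- by rewrite /b -(intrB _ a 1); apply: (@intr_F3_eq _ _ a); ring.
- by rewrite /b -(intrD _ a 1); apply: (@intr_F3_eq _ _ (- 3 * a - 1)); ring.
- by rewrite /b; apply: (@intr_F3_eq _ _ (- 3 * a)); ring.
Qed.

Theorem theorem2p1 (a : int) (ha : ~~ (3 %| a)%Z) :
  irreducible_poly (map_poly (intr : int -> 'F_3) (f_ a)) /\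
  irreducible_elt (f_ a).
Proof.
have b0 : a%:~R != 0 :> 'F_3 by rewrite intr_F3_eq0.
have a0 : - 8 * a != 0.
  by rewrite mulf_neq0 //; apply: contraNneq ha => ->.
(* [PolyK] asks for a nonzero last coefficient: [a0] supplies it over the integers and [b0] modulo
   3. *)
have szf : size (f_ a) = 4%N by rewrite f_Poly (@PolyK _ 0).
have szm : size (map_poly (intr : int -> 'F_3) (f_ a)) = 4%N.
  by rewrite map_f_F3 (@PolyK _ 0).
have lcf0 : (lead_coef (f_ a))%:~R != 0 :> 'F_3.
  by rewrite lead_coefE szf -coef_map map_f_F3 coef_Poly.
have irr : irreducible_poly (map_poly (intr : int -> 'F_3) (f_ a)).
  apply: cubic_irreducible => [|x]; first by rewrite szm.
  by rewrite map_f_F3 /root horner_cubic; apply: cubic_F3_no_root.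
split; first exact: irr.
exact: (irreducible_elt_of_map lcf0 (@f_primitive a) irr).
Qed.
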